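(* For every real number $\epsilon>0$ and every fixed natural number $r\ge 2$, with probability tending to $1$ as $n\to\infty$, $$\chi\left(\widetilde{C}_{\mathrm{Hom}_p(K_r,\,G(n,\frac12))}\right)\leq \left(r+\frac{2}{r-1}+\epsilon\right)\log_2 n.$$
   Context: $G(n,p)$ is the random graph on labeled vertex set $[n]=\{1,\dots,n\}$ in which each edge appears independently with probability $p$. For graphs $F$ with $V(F)=[r]$ and $H$, the Hom-poset $\mathrm{Hom}_p(F,H)$ consists of all $r$-tuples $(A_1,\dots,A_r)$ of non-empty subsets of $V(H)$ such that for every edge $\{i,j\}$ of $F$ and every $x\in A_i$, $y\in A_j$, $\{x,y\}$ is an edge of $H$; it is ordered by $(A_1,\dots,A_r)\le(B_1,\dots,B_r)$ iff $A_i\subseteq B_i$ for all $i$. $K_r$ is the complete graph on $[r]$. The cyclic group $\mathbb{Z}_r=\{\omega^0=e,\omega,\dots,\omega^{r-1}\}$ acts on $\mathrm{Hom}_p(K_r,H)$ by cyclic shift: $\omega^i\cdot(A_1,\dots,A_r)=(A_{1+i},\dots,A_{r+i})$, indices taken modulo $r$ in $[r]$; this makes it a free $\mathbb{Z}_r$-poset. For a $G$-poset $P$ (order-preserving $G$-action) with $[x]=\{g\cdot x:g\in G\}$, the strong compatibility graph $\widetilde{C}_P$ has vertex set $P$, with $x,y$ adjacent if there is $g\in G\setminus\{e\}$ such that $x$ and $g\cdot y$ are comparable and $y\notin[x]$. $\chi$ is the chromatic number. *)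

(* Defs.v *)
From Stdlib Require Import Reals.
From mathcomp Require Import all_boot.
Delimit Scope R_scope with Re.
Set Implicit Arguments. Unset Strict Implicit. Unset Printing Implicit Defensive.

(* A graph on vertex set 'I_n is its edge set E : {set {set 'I_n}}, a set of
   2-element subsets.  {x,y} is an edge iff [set x; y] \in E. *)
Definition two_sets (n : nat) : {set {set 'I_n}} := [set e : {set 'I_n} | #|e| == 2].

Definition graphs (n : nat) : {set {set {set 'I_n}}} := powerset (two_sets n).

(* Probability of an event Q in G(n,1/2): uniform measure on labeled graphs
   (each edge present independently with probability 1/2). *)
Definition prob_Gn_half (n : nat) (Q : {set {set 'I_n}} -> bool) : R :=
  (INR #|[set E in graphs n | Q E]| / INR #|graphs n|)%Re.

Definition htuple (r n : nat) := {ffun 'I_r -> {set 'I_n}}.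

Definition hom_poset (r n : nat) (F : rel 'I_r) (E : {set {set 'I_n}})
  : {set htuple r n} :=
  [set A : htuple r n |
     [forall i, A i != set0] &&
     [forall i, forall j, F i j ==>
        [forall x in A i, forall y in A j, [set x; y] \in E]]].

Definition K_rel (r : nat) : rel 'I_r := fun i j => i != j.

Definition hle (r n : nat) (A B : htuple r n) : bool := [forall i, A i \subset B i].

Lemma ord_pos (r : nat) (j : 'I_r) : 0 < r.
Proof. exact: leq_ltn_trans (leq0n j) (ltn_ord j). Qed.

Definition ord_addr (r : nat) (j i : 'I_r) : 'I_r :=
  Ordinal (ltn_pmod (j + i) (ord_pos j)).

(* omega^i . (A_1,...,A_r) = (A_{1+i},...,A_{r+i}); here g = omega^(val g). *)
Definition cshift (r n : nat) (g : 'I_r) (A : htuple r n) : htuple r n :=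
  [ffun j => A (ord_addr j g)].

Definition orbit_of (r n : nat) (A : htuple r n) : {set htuple r n} :=
  [set cshift g A | g : 'I_r].

Definition scomp_adj (r n : nat) : rel (htuple r n) := fun x y =>
  [exists g : 'I_r, (val g != 0) &&
     (hle x (cshift g y) || hle (cshift g y) x)] && (y \notin orbit_of x).

Definition colorable (T : finType) (V : {set T}) (adj : rel T) (k : nat) : bool :=
  [exists f : {ffun T -> 'I_k},
     [forall x in V, forall y in V, ((x != y) && adj x y) ==> (f x != f y)]].

Lemma colorable_card (T : finType) (V : {set T}) (adj : rel T) :
  exists k, colorable V adj k.
Proof.
exists #|T|; apply/existsP; exists [ffun x => enum_rank x].
apply/forallP => x; apply/implyP => _; apply/forallP => y; apply/implyP => _.
apply/implyP => /andP [nxy _]; rewrite !ffunE.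
by apply: contra nxy => /eqP /enum_rank_inj ->.
Qed.

Definition chromatic_number (T : finType) (V : {set T}) (adj : rel T) : nat :=
  ex_minn (colorable_card V adj).

Definition log2 (x : R) : R := (ln x / ln 2)%Re.

(* Main.v *)
Require Import Defs.
From Stdlib Require Import Reals Lra.
From mathcomp Require Import all_boot.
From mathcomp Require Import zify.
(** Put [q = ceil (log2 (n r))] and [t = 2 q + 1].  With high probability every
    [(A_1, ..., A_r)] in the Hom-poset satisfies [sum_i min(|A_i|, t) < 2 t]:
    otherwise one could shrink the [A_i] to sets of size at most [t] and total
    size exactly [2 t], which force at least
    [((2 t)^2 - t * 2 t) / 2 = t^2] edges, while there are at most
    [(n r)^(2 t) <= 2^(2 t q)] such families; the union bound gives
    [2^(2 t q - t^2) = 2^(-t)].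

    On such a graph at most one [A_i] has size at least [t].  If it exists,
    colour the tuple by [i]; otherwise by its total size, which is below [2 t].
    A nontrivial shift moves the large coordinate, and total size is strictly
    monotone and shift invariant, so this is a proper colouring with
    [r + 2 t = 4 log2 n + O(1)] colours.  Finally [4 <= r + 2 / (r - 1)], because
    the difference is [(r - 2) (r - 3) / (r - 1)]. *)

Set Implicit Arguments. Unset Strict Implicit. Unset Printing Implicit Defensive.

(** * Cyclic shifts of tuples and their effect on total size *)

Section CyclicShift.
Variables r n : nat.
Implicit Types x y : htuple r n.

(** The inverse of [g] modulo [r]; the reduction sends [r - 0] back to [0]. *)
Definition ord_opp (g : 'I_r) : 'I_r :=
  Ordinal (ltn_pmod (r - g) (ord_pos g)).

Lemma ord_addrK (g i : 'I_r) : ord_addr (ord_addr i g) (ord_opp g) = i.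
Proof.
apply: val_inj; rewrite /= modnDm.
by rewrite -addnA subnKC ?modnDr ?modn_small // ltnW.
Qed.

Lemma ord_oppK_addr (g i : 'I_r) : ord_addr (ord_addr i (ord_opp g)) g = i.
Proof.
apply: val_inj; rewrite /= modnDmr modnDml.
by rewrite -addnA subnK ?modnDr ?modn_small // ltnW.
Qed.

Lemma ord_addr_bij (g : 'I_r) : bijective (fun i : 'I_r => ord_addr i g).
Proof.
by exists (fun i => ord_addr i (ord_opp g)) => i; [exact: ord_addrK | exact: ord_oppK_addr].
Qed.

Lemma ord_opp_neq0 (g : 'I_r) : val g != 0 -> val (ord_opp g) != 0.
Proof.
rewrite -!lt0n /= => g0; rewrite modn_small ?subn_gt0 //.
by have := ltn_ord g; lia.
Qed.

Lemma ord_addr_neq (g i : 'I_r) : val g != 0 -> ord_addr i g != i.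
Proof.
rewrite -lt0n => g0; apply/eqP => /(congr1 val) /= eq_i.
have ltg := ltn_ord g; have lti := ltn_ord i; rewrite /= in g0.
have [lt_r|ge_r] := ltnP (i + g) r; first by rewrite modn_small // in eq_i; lia.
have : (i + g) %% r = i + g - r.
  by rewrite -{1}(subnK ge_r) modnDr modn_small //; lia.
by lia.
Qed.

Lemma cshiftK (g : 'I_r) x : cshift (ord_opp g) (cshift g x) = x.
Proof. by apply/ffunP => i; rewrite !ffunE ord_oppK_addr. Qed.

Lemma hle_cshift (g : 'I_r) x y : hle x y -> hle (cshift g x) (cshift g y).
Proof. by move=> /forallP le_xy; apply/forallP => i; rewrite !ffunE. Qed.

Lemma sum_card_cshift (g : 'I_r) x : \sum_i #|cshift g x i| = \sum_i #|x i|.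
Proof.
rewrite [RHS](reindex _ (onW_bij _ (ord_addr_bij g))).
by apply: eq_bigr => i _; rewrite ffunE.
Qed.

(** Equal sums would force equal cardinalities in every coordinate, and an inclusion between finite
    sets of the same size is an equality. *)
Lemma hle_sum_card x y : hle x y -> x != y -> \sum_i #|x i| < \sum_i #|y i|.
Proof.
move=> /forallP le_xy; apply: contraR; rewrite -leqNgt => le_yx.
have := leqif_sum (fun i (_ : true) => subset_leqif_card (le_xy i)).
case=> le_sum; rewrite eqn_leq le_sum le_yx => /esym/forallP sub_yx.
by apply/eqP/ffunP => i; apply/eqP; rewrite eqEsubset le_xy; apply: sub_yx.
Qed.

End CyclicShift.

(** * Colouring the strong compatibility graph *)

Lemma colorable_nat (T : finType) (V : {set T}) (adj : rel T) k (c : T -> nat) :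
  0 < k -> {in V, forall x, c x < k} ->
  {in V &, forall x y, adj x y -> c x <> c y} -> colorable V adj k.
Proof.
(* On [V] the value is [c x] by [lt_c]; outside [V] it may fall back to the default [0]. *)
move=> k0 lt_c proper; apply/existsP; exists [ffun x => insubd (Ordinal k0) (c x)].
apply/forall_inP => x Vx; apply/forall_inP => y Vy.
apply/implyP => /andP[_ adj_xy]; rewrite !ffunE; apply/eqP => /(congr1 val).
by rewrite !val_insubd !lt_c //; apply: proper.
Qed.

Section Colouring.
Variables r n t : nat.
Implicit Types x y : htuple r n.

(** Truncation lets a single huge coordinate count for only [t], whereas two large ones already
    reach [2 t]. *)
Definition truncated_size x := \sum_i minn #|x i| t.

(** The offset [r] keeps the colours given by sizes apart from those given by indices. *)
Definition colour x : nat :=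
  if [pick i | t <= #|x i|] is Some i then nat_of_ord i else r + \sum_i #|x i|.

Lemma large_unique x i j : truncated_size x < t.*2 ->
  t <= #|x i| -> t <= #|x j| -> i = j.
Proof.
move=> small ti tj; apply/eqP; apply: contraLR small => neq_ij.
rewrite -leqNgt /truncated_size (bigD1 i) //= (bigD1 j) /=; last by rewrite eq_sym.
by rewrite (minn_idPr ti) (minn_idPr tj) addnA addnn leq_addr.
Qed.

Lemma colour_bound x : truncated_size x < t.*2 -> colour x < r + t.*2.
Proof.
rewrite /colour; case: pickP => [i _ _|small lt_t]; first by have := ltn_ord i; lia.
rewrite ltn_add2l; apply: leq_ltn_trans lt_t.
by apply: leq_sum => i _; have := small i; lia.
Qed.

(** If both colours were the index [i], then [y] would be large at [i] and, since it contains [x i],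
    also at the distinct index [i + g]. If both are sizes, strict monotonicity separates them. *)
Lemma colour_shift (g : 'I_r) x y : truncated_size y < t.*2 ->
  val g != 0 -> hle x (cshift g y) -> x != cshift g y -> colour x <> colour y.
Proof.
move=> small g0 le_xy neq_xy; rewrite /colour.
case: pickP => [i ti|_]; case: pickP => [j tj|nolarge].
- move/ord_inj => eq_ij; subst j; have /eqP[] := ord_addr_neq i g0.
  apply: (large_unique small) tj; apply: leq_trans ti (subset_leq_card _).
  by have /forallP/(_ i) := le_xy; rewrite ffunE.
- by have := ltn_ord i; lia.
- by have := ltn_ord j; lia.
- move=> /addnI eq_s; have := hle_sum_card le_xy neq_xy.
  by rewrite sum_card_cshift eq_s ltnn.
Qed.

Lemma truncated_size_chromatic (V : {set htuple r n}) : 0 < t ->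
  {in V, forall x, truncated_size x < t.*2} ->
  chromatic_number V (@scomp_adj r n) <= r + t.*2.
Proof.
move=> t0 small; rewrite /chromatic_number; case: ex_minnP => k _; apply.
apply: (@colorable_nat _ _ _ _ colour); first by lia.
  by move=> x /small/colour_bound.
move=> x y Vx Vy /andP[/existsP[g /andP[g0 /orP[le_xy|le_yx]]]] notin.
  apply: (colour_shift (small y Vy) g0 le_xy).
  (* If [x] were [cshift g y], the inverse shift would put [y] in the orbit of [x]. *)
  apply: contraNneq notin => ->; apply/imsetP; exists (ord_opp g) => //.
  by rewrite cshiftK.
(* Undoing the shift turns [cshift g y <= x] into [y <= cshift (ord_opp g) x], the previous case
   with [x] and [y] exchanged. *)
apply/nesym/(colour_shift (small x Vx) (ord_opp_neq0 g0)).
  by rewrite -{1}(cshiftK g y) hle_cshift.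
by apply: contraNneq notin => ->; apply/imsetP; exists (ord_opp g).
Qed.

End Colouring.

(** * Counting graphs that contain forced edges *)

Lemma card_supersets (T : finType) (U D : {set T}) :
  #|[set E in powerset U | D \subset E]| * 2 ^ #|D| <= #|powerset U|.
Proof.
have [DU|nDU] := boolP (D \subset U); last first.
  rewrite (_ : [set E in _ | _] = set0) ?cards0 //; apply/setP => E.
  rewrite !inE; apply/negP => /andP[EU DE]; case/negP: nDU.
  exact: subset_trans DE EU.
rewrite -card_powerset -cardsX.
(* Overwrite the part of [E] inside [D] by an arbitrary [D']. As [D] lies in [E], nothing is lost:
   the result determines [E] outside [D] and [D'] inside it. *)
pose f (p : {set T} * {set T}) := (p.1 :\: D) :|: p.2.
have f_inj : {in setX [set E in powerset U | D \subset E] (powerset D) &, injective f}.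
  move=> [E1 D1] [E2 D2]; rewrite !inE /= => /andP[/andP[_ DE1] D1D].
  move=> /andP[/andP[_ DE2] D2D] /setP eq_f.
  congr pair; apply/setP => z; have := eq_f z; rewrite !inE;
  have := subsetP DE1 z; have := subsetP DE2 z;
  have := subsetP D1D z; have := subsetP D2D z;
  by case: (z \in D); case: (z \in E1); case: (z \in E2); case: (z \in D1); case: (z \in D2);
    rewrite //= => h1 h2 h3 h4 //; by [have := h1 isT | have := h2 isT | have := h3 isT | have := h4 isT].
rewrite -(card_in_imset f_inj); apply/subset_leq_card/subsetP => X.
case/imsetP => -[E D']; rewrite !inE /= => /andP[/andP[EU _] D'D] ->.
rewrite subUset (subset_trans D'D DU) andbT.
exact: subset_trans (subsetDl _ _) EU.
Qed.

Lemma subset_of_card (T : finType) (A : {set T}) k :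
  k <= #|A| -> exists2 B : {set T}, B \subset A & #|B| = k.
Proof.
move=> le_k; exists [set x in take k (enum A)].
  by apply/subsetP => x; rewrite inE => /mem_take; rewrite mem_enum.
rewrite cardsE (card_uniqP _) ?take_uniq ?enum_uniq //.
by rewrite size_takel // -cardE.
Qed.

Lemma bin_leq_expn m k : 'C(m, k) <= m ^ k.
Proof.
apply: leq_trans (leq_pmulr _ (fact_gt0 k)) _; rewrite bin_ffact ffact_prod.
rewrite -[k in _ ^ k]card_ord -prod_nat_const.
by apply: leq_prod => i _; apply: leq_subr.
Qed.

(* A family of vertex sets [B_1, ..., B_r] is encoded by the single set
   [W] of pairs [(a, i)] with [a] in [B_i], so that the families of total size
   [k] are counted by one binomial coefficient. *)
Section ForcedEdges.
Variables r n t : nat.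
Implicit Types (W : {set 'I_n * 'I_r}) (E : {set {set 'I_n}}).

(** The pairs are ordered, so each forced edge arises at least twice; this explains the doublings in
    the bounds below. *)
Definition cross_pairs W :=
  [set p in setX W W | p.1.2 != p.2.2].

Definition cross_edges W : {set {set 'I_n}} :=
  [set [set p.1.1; p.2.1] | p in cross_pairs W].

Definition thin W := [forall i : 'I_r, #|[set w in W | w.2 == i]| <= t].

(** Of the [(2 t)^2] ordered pairs, at most [2 t * t] stay within one fibre, as each element has at
    most [t] partners there. *)
Lemma card_cross_pairs W : thin W -> #|W| = t.*2 ->
  (t * t).*2 <= #|cross_pairs W|.
Proof.
move=> /forallP W_thin cW.
have split_W : #|cross_pairs W| + \sum_(w in W) #|[set w' in W | w'.2 == w.2]| = #|W| * #|W|.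
  rewrite -cardsX -(cardsID [set p | p.1.2 != p.2.2] (setX W W)); congr (_ + _).
    by apply: eq_card => p; rewrite !inE.
  rewrite -sum1_card (eq_bigr (fun w => \sum_(w' in W | w'.2 == w.2) 1)); last first.
    by move=> w _; rewrite sum1dep_card.
  rewrite pair_big_dep /=; apply: eq_bigl => -[a b].
  by rewrite !inE /= negbK (eq_sym b.2) andbA andbC.
have : \sum_(w in W) #|[set w' in W | w'.2 == w.2]| <= \sum_(w in W) t.
  by apply: leq_sum => w _; apply: W_thin.
rewrite sum_nat_const cW; move: split_W; rewrite cW; nia.
Qed.

(** A vertex shared by two of the sets [B_i] would force a loop, a one-element member of [E]. Hence
    the [B_i] are pairwise disjoint. *)
Lemma cross_edges_inj W E : E \in graphs n -> cross_edges W \subset E ->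
  {in W &, injective (fun w => w.1)}.
Proof.
rewrite powersetE => /subsetP E2 /subsetP WE [a i] [b j] Wa Wb /= eq_ab; subst b.
congr pair; apply/eqP; apply/negP => /negP neq_ij.
have /E2 : [set a; a] \in E.
  by apply/WE/imsetP; exists ((a, i), (a, j)) => //; rewrite !inE /= Wa Wb.
by rewrite inE setUid cards1.
Qed.

Lemma card_cross_edges W E : E \in graphs n -> cross_edges W \subset E ->
  #|cross_pairs W| <= #|cross_edges W|.*2.
Proof.
move=> gE WE; have inj := cross_edges_inj gE WE.
rewrite -sum1_card (partition_big (fun p => [set p.1.1; p.2.1]) (mem (cross_edges W))) /=;
  last by move=> p Qp; apply: imset_f.
rewrite -muln2 -sum_nat_const; apply: leq_sum => d /imsetP[[a b] Qab ->].
rewrite sum1dep_card.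
(* By disjointness a vertex determines its index, so an edge comes from one pair and its reversal
   only. *)
apply: (@leq_trans #|[set (a, b); (b, a)]|); last by rewrite cards2; case: (_ == _).
apply/subset_leq_card/subsetP => -[u v]; rewrite !inE /= in Qab *.
move: Qab => /andP[/andP[Wa Wb] ab] /andP[/andP[/andP[Wu Wv] uv]] /eqP/setP eq_s.
have := eq_s u.1; have := eq_s v.1; have := eq_s a.1; have := eq_s b.1.
rewrite !inE !eqxx ?orbT /= !(inj_in_eq inj) // !xpair_eqE.
rewrite ?(eq_sym a) ?(eq_sym b).
by case: (u == a); case: (u == b); case: (v == a); case: (v == b).
Qed.

Definition bad_graphs W := [set E in graphs n | cross_edges W \subset E].

Lemma card_bad_graphs W : thin W -> #|W| = t.*2 ->
  #|bad_graphs W| * 2 ^ (t * t) <= #|graphs n|.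
Proof.
(* The lower bound on distinct forced edges needs some graph containing them, so the empty case is
   settled first. *)
move=> W_thin cW; have [->|[E]] := set_0Vmem (bad_graphs W); first by rewrite cards0.
rewrite inE => /andP[gE WE]; have := card_cross_edges gE WE.
have := card_cross_pairs W_thin cW => le1 /(leq_trans le1); rewrite leq_double => le_t.
apply: leq_trans (card_supersets (two_sets n) (cross_edges W)).
by rewrite leq_mul // leq_exp2l.
Qed.

(** Shrink every [x i] to [min(|x i|, t)] vertices, then discard pairs until exactly [2 t] remain;
    thinness and the edges across fibres survive both reductions. *)
Lemma hom_large_truncation E (x : htuple r n) :
  x \in hom_poset (@K_rel r) E -> t.*2 <= truncated_size t x ->
  exists W, [/\ thin W, #|W| = t.*2 & cross_edges W \subset E].
Proof.
rewrite inE => /andP[_ /forallP xE] large.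
have subx i : exists B : {set 'I_n}, (B \subset x i) && (#|B| == minn #|x i| t).
  by have [B Bx cB] := subset_of_card (geq_minl #|x i| t); exists B; rewrite Bx cB eqxx.
pose B i := xchoose (subx i).
have Bx i : B i \subset x i by have /andP[] := xchooseP (subx i).
have cB i : #|B i| = minn #|x i| t by have /andP[_ /eqP] := xchooseP (subx i).
pose W0 := [set w : 'I_n * 'I_r | w.1 \in B w.2].
have fibre i : #|[set w in W0 | w.2 == i]| = #|B i|.
  rewrite -(card_imset (B i) (f := fun a => (a, i))); last by move=> a b [].
  apply: eq_card => -[a j]; rewrite !inE /=; apply/andP/imsetP.
    by move=> [Ba /eqP eq_j]; exists a; rewrite -eq_j.
  by case=> b Bb [-> ->].
have cW0 : #|W0| = truncated_size t x.
  rewrite -sum1_card (partition_big (fun w => w.2) predT) //=.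
  by apply: eq_bigr => i _; rewrite sum1dep_card fibre cB.
rewrite -cW0 in large; have [W WW0 cW] := subset_of_card large.
exists W; split=> //.
  apply/forallP => i; apply: (@leq_trans #|B i|); last by rewrite cB geq_minr.
  rewrite -fibre; apply/subset_leq_card/subsetP => w; rewrite !inE => /andP[/(subsetP WW0)].
  by rewrite inE => -> ->.
apply/subsetP => d /imsetP[[[a i] [b j]]]; rewrite !inE /= => /andP[/andP[Wa Wb] neq_ij] ->.
have /forallP/(_ j)/implyP/(_ neq_ij)/forall_inP/(_ a) := xE i.
have := subsetP WW0 _ Wa; have := subsetP WW0 _ Wb; rewrite !inE /=.
by move=> /(subsetP (Bx j)) xb /(subsetP (Bx i)) xa /(_ xa)/forall_inP/(_ b xb).
Qed.

Definition large_hom_graphs := [set E in graphs n |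
  [exists x in hom_poset (@K_rel r) E, t.*2 <= truncated_size t x]].

(** Union bound over the thin [W] of size [2 t], of which there are at most ['C(n * r, 2 t)]. *)
Lemma card_large_hom_graphs :
  #|large_hom_graphs| * 2 ^ (t * t) <= (n * r) ^ t.*2 * #|graphs n|.
Proof.
pose good := [set W : {set 'I_n * 'I_r} | #|W| == t.*2 & thin W].
have le_card : #|large_hom_graphs| <= \sum_(W in good) #|bad_graphs W|.
  apply: (@leq_trans #|\bigcup_(W in good) bad_graphs W|).
    apply/subset_leq_card/subsetP => E; rewrite inE => /andP[gE /exists_inP[x Vx large]].
    have [W [W_thin cW WE]] := hom_large_truncation Vx large.
    by apply/bigcupP; exists W; rewrite inE ?cW ?eqxx ?W_thin ?gE.
  elim/big_rec2: _ => [|W k S _ le_S]; first by rewrite cards0.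
  by apply: leq_trans (leq_card_setU _ _) _; rewrite leq_add2l.
have le_good : #|good| <= (n * r) ^ t.*2.
  apply: (@leq_trans 'C(n * r, t.*2)).
    rewrite -[n in 'C(n * _, _)]card_ord -[r in 'C(_ * r, _)]card_ord -card_prod -card_draws.
    by apply/subset_leq_card/subsetP => W; rewrite !inE => /andP[].
  exact: bin_leq_expn.
apply: leq_trans (leq_mul le_card (leqnn _)) _.
rewrite big_distrl /=; apply: leq_trans (_ : \sum_(W in good) #|graphs n| <= _).
  by apply: leq_sum => W; rewrite inE => /andP[/eqP cW W_thin]; apply: card_bad_graphs.
by rewrite sum_nat_const leq_mul2r le_good orbT.
Qed.

End ForcedEdges.

(** * The choice of [t] and the resulting failure bound [1 / n] *)

Definition logsize (r n : nat) := up_log 2 (n * r).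

Lemma chromatic_number_whp (r n : nat) : 0 < r ->
  let good := [set E in graphs n |
    chromatic_number (hom_poset (@K_rel r) E) (@scomp_adj r n)
      <= r + (4 * logsize r n + 2)] in
  #|graphs n :\: good| * n <= #|graphs n|.
Proof.
move=> r0 /=; set q := logsize r n; set good := finset _; pose t := q.*2.+1.
have nrq : n * r <= 2 ^ q by apply: up_logP.
have sub : graphs n :\: good \subset large_hom_graphs r n t.
  apply/subsetP => E; rewrite !inE => /andP[nochi gE]; rewrite gE /= in nochi *.
  apply: contraR nochi => /exists_inPn small.
  have -> : 4 * q + 2 = t.*2 by rewrite /t; lia.
  by apply: truncated_size_chromatic => // x /small; rewrite -ltnNge.
have le_large := card_large_hom_graphs r n t.
have pow_t : (n * r) ^ t.*2 * n <= 2 ^ (t * t).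
  (* The first summand of the exponent absorbs [(n r)^(2 t)]; the spare factor [2^t] is at least
     [2^q >= n r >= n]. *)
  have -> : t * t = q * t.*2 + t by rewrite /t; nia.
  rewrite expnD leq_mul //; first by rewrite expnM leq_exp2r.
  apply: leq_trans (leq_pmulr n r0) _; apply: leq_trans nrq _.
  by rewrite leq_exp2l // /t; lia.
rewrite -(@leq_pmul2r (2 ^ (t * t))) ?expn_gt0 //.
apply: leq_trans (_ : (#|large_hom_graphs r n t| * 2 ^ (t * t)) * n <= _).
  by rewrite mulnAC !leq_mul // subset_leq_card.
apply: leq_trans (leq_mul le_large (leqnn n)) _.
by rewrite mulnAC mulnC leq_mul.
Qed.

(** * Real logarithms and passage to the limit *)

Lemma INR_expn (a k : nat) : INR (a ^ k) = (INR a ^ k)%Re.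
Proof. by elim: k => [|k IH] //; rewrite expnS mult_INR IH. Qed.

Lemma INR_le (a b : nat) : a <= b -> (INR a <= INR b)%Re.
Proof. by move/leP; apply: le_INR. Qed.

Lemma INR_gt0 (a : nat) : 0 < a -> (0 < INR a)%Re.
Proof. by move/ltP; apply: lt_0_INR. Qed.

Local Open Scope R_scope.

Lemma ln2_gt0 : 0 < ln 2.
Proof. by rewrite -ln_1; apply: ln_increasing; lra. Qed.

Lemma ln_le (x y : R) : 0 < x -> x <= y -> ln x <= ln y.
Proof.
move=> x0 [lt_xy|->]; last exact: Rle_refl.
exact/Rlt_le/ln_increasing.
Qed.

(** By minimality of [q = logsize r n], [2^(q - 1) < n r]; take logarithms. *)
Lemma logsize_bound (r n : nat) : (2 <= r)%N -> (1 <= n)%N ->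
  INR (logsize r n) <= 1 + log2 (INR n) + log2 (INR r).
Proof.
move=> r2 n1; have nr1 : (1 < n * r)%N by nia.
have := up_log_gtn (isT : (1 < 2)%N) nr1; rewrite -/(logsize r n) => /ltnW/INR_le.
have q0 : (0 < logsize r n)%N by rewrite up_log_gt0.
have n0 := INR_gt0 n1; have r0 : 0 < INR r by apply: INR_gt0; lia.
rewrite INR_expn mult_INR => le_pow.
have := ln_le (pow_lt 2 _ ltac:(lra)) le_pow.
rewrite ln_mult // ln_pow; last by lra.
have -> : INR (logsize r n) = INR (logsize r n).-1 + 1.
  by rewrite -S_INR prednK.
have l2 := ln2_gt0 => le_ln; rewrite /log2.
suff : INR (logsize r n).-1 <= ln (INR n) / ln 2 + ln (INR r) / ln 2 by lra.
apply: (Rmult_le_reg_r (ln 2)) => //.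
by rewrite Rmult_plus_distr_r /Rdiv !Rmult_assoc !Rinv_l; lra.
Qed.

Lemma four_le_ratio (r : nat) : (2 <= r)%N -> 4 <= INR r + 2 / (INR r - 1).
Proof.
move=> r2; have r1 : 2 <= INR r by have := INR_le r2.
have : 0 <= (INR r - 2) * (INR r - 3).
  (* Integrality matters: the product is negative strictly between [2] and [3]. *)
  have [->|r3] := eqVneq r 2%N; first by rewrite /=; lra.
  have : INR 3 <= INR r by apply: INR_le; lia.
  by rewrite /= => ?; apply: Rmult_le_pos; lra.
move=> sq; suff : 0 <= (INR r + 2 / (INR r - 1) - 4) by lra.
have -> : INR r + 2 / (INR r - 1) - 4 = (INR r - 2) * (INR r - 3) / (INR r - 1).
  by field; lra.
by apply: Rmult_le_pos => //; apply/Rlt_le/Rinv_0_lt_compat; lra.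
Qed.

Lemma log2_eventually_ge (C : R) :
  exists N : nat, forall n : nat, (N <= n)%N -> (1 <= n)%N /\ C <= log2 (INR n).
Proof.
(* This yields [N > 2^C], written through inverses. *)
have [N [lt_N N0]] := archimed_cor1 (/ exp (C * ln 2)) (Rinv_0_lt_compat _ (exp_pos _)).
exists N => n le_n; split; first by apply: leq_trans le_n; apply/ltP.
have N0' : 0 < INR N by apply: lt_0_INR.
have le_nR := INR_le le_n.
have lt_exp : exp (C * ln 2) < INR N.
  rewrite -(Rinv_inv (INR N)) -(Rinv_inv (exp _)); apply: Rinv_0_lt_contravar => //.
  exact: Rinv_0_lt_compat.
have := ln_le (exp_pos (C * ln 2)) (Rlt_le _ _ (Rlt_le_trans _ _ _ lt_exp le_nR)).
rewrite ln_exp => le_ln; have l2 := ln2_gt0.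
apply: (Rmult_le_reg_r (ln 2)) => //.
by rewrite /log2 /Rdiv Rmult_assoc Rinv_l; lra.
Qed.

Lemma prob_complement_bound (n : nat) (Q : {set {set 'I_n}} -> bool) :
  (1 <= n)%N -> (#|graphs n :\: [set E in graphs n | Q E]| * n <= #|graphs n|)%N ->
  1 - / INR n <= prob_Gn_half Q <= 1.
Proof.
move=> n1; set good := [set E in _ | _] => le_bad; have n0 := INR_gt0 n1.
have G0 : 0 < INR #|graphs n| by apply: INR_gt0; rewrite card_powerset expn_gt0.
have split_G : (#|graphs n| = #|good| + #|graphs n :\: good|)%N.
  rewrite -(cardsID good (graphs n)); congr (_ + _)%N.
  by rewrite (setIidPr _) //; apply/subsetP => E; rewrite inE => /andP[].
have := INR_le le_bad; have := f_equal INR split_G.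
rewrite mult_INR plus_INR /prob_Gn_half -/good => eqG leB.
have B0 := pos_INR #|graphs n :\: good|.
split; apply: (Rmult_le_reg_r (INR #|graphs n|)) => //;
  rewrite /Rdiv (Rmult_assoc (INR #|good|)) Rinv_l; try lra.
suff : INR #|graphs n :\: good| <= / INR n * INR #|graphs n| by lra.
apply: (Rmult_le_reg_r (INR n)) => //.
have -> : / INR n * INR #|graphs n| * INR n = INR #|graphs n| by field; lra.
by [].
Qed.

Theorem theorem13 (eps : R) (r : nat) :
  (0 < eps)%Re -> (2 <= r)%N ->
  Un_cv
    (fun n : nat =>
       prob_Gn_half (fun E : {set {set 'I_n}} =>
         if Rle_dec
           (INR (chromatic_number (hom_poset (@K_rel r) E) (@scomp_adj r n)))
           ((INR r + 2 / (INR r - 1) + eps) * log2 (INR n))%Re then true else false))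
    1%Re.
Proof.
move=> eps0 r2 d d0.
(* The bound [r + 4 q + 2] is at most [4 log2 n + (r + 6 + 4 log2 r)], and [eps * log2 n] must
   absorb the constant. The maximum with [0] gives [log2 n >= 0], so that [four_le_ratio] can be
   multiplied by it. *)
have [N0 big_log] := log2_eventually_ge (Rmax 0 ((INR r + 6 + 4 * log2 (INR r)) / eps)).
have [N1 [lt_N1 N1pos]] := archimed_cor1 d d0.
exists (N0 + N1)%N => n /leP le_n.
have [n1 le_max] := big_log n (leq_trans (leq_addr _ _) le_n).
have log0 := Rle_trans _ _ _ (Rmax_l _ _) le_max.
have le_log := Rle_trans _ _ _ (Rmax_r _ _) le_max.
set Q := (Q in prob_Gn_half Q).
have le_bad : (#|graphs n :\: [set E in graphs n | Q E]| * n <= #|graphs n|)%N.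
  apply: leq_trans (chromatic_number_whp n (ltnW r2)); rewrite leq_mul2r; apply/orP; right.
  apply/subset_leq_card/setDS/subsetP => E; rewrite !inE => /andP[-> /INR_le le_chi].
  rewrite /Q; case: Rle_dec => // -[]; apply: Rle_trans le_chi _.
  have := logsize_bound r2 n1; have := four_le_ratio r2.
  rewrite plus_INR (plus_INR (4 * _)) mult_INR [INR 4]/= [INR 2]/= => ge4 le_q.
  have le_eps : INR r + 6 + 4 * log2 (INR r) <= eps * log2 (INR n).
    have := Rmult_le_compat_l eps _ _ (Rlt_le _ _ eps0) le_log.
    by have -> : eps * ((INR r + 6 + 4 * log2 (INR r)) / eps) = INR r + 6 + 4 * log2 (INR r)
      by field; lra.
  have := Rmult_le_compat_r _ _ _ log0 ge4; lra.
have [lo hi] := prob_complement_bound n1 le_bad.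
have N1R : 0 < INR N1 by apply: lt_0_INR.
have := Rinv_le_contravar _ _ N1R (INR_le (leq_trans (leq_addl N0 N1) le_n)).
by rewrite /Rdist Rabs_left1; lra.
Qed.
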